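(* Let $p<q<r$ be odd primes. Let $\rho$ and $\sigma$ be the unique non-negative integers such that $(p-1)(q-1)=\rho p+\sigma q$, and put $\tau=(p-1)(q+r-1)$. If $qr>\tau$, then $$h(\Psi_{pqr}(x))\le\max\{\min(\rho+1,\sigma+1),\ \min(q-1-\rho,\ p-1-\sigma)\}.$$
   Context: $\Phi_n(x)$ is the $n$-th cyclotomic polynomial and $\Psi_n(x)=(x^n-1)/\Phi_n(x)\in\mathbb Z[x]$. The height $h(f)$ of $f\in\mathbb Z[x]$ is the maximum absolute value of its coefficients. *)

(* Defs.v *)
From mathcomp Require Import all_boot all_order all_algebra all_field.

Set Implicit Arguments.
Unset Strict Implicit.
Unset Printing Implicit Defensive.

Import GRing.Theory.
Local Open Scope ring_scope.

Definition height (f : {poly int}) : nat := \max_(i < size f) `|(f`_i)%R|.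

(* [%/] on {poly int} is a pseudo-division, but it is the Euclidean one when   *)
(* the divisor is monic, as ['Phi_n] is; see [inverse_CyclotomicM].            *)
Definition inverse_Cyclotomic (n : nat) : {poly int} := ('X^n - 1) %/ 'Phi_n.

Notation "''Psi_' n" := (inverse_Cyclotomic n)
  (at level 8, n at level 2, format "''Psi_' n").

Lemma inverse_CyclotomicM (n : nat) :
  (0 < n)%N -> 'Psi_n * 'Phi_n = 'X^n - 1.
Proof.
move=> n_gt0; rewrite /inverse_Cyclotomic -(prod_Cyclotomic n_gt0).
have n_div : n \in divisors n by rewrite -dvdn_divisors.
rewrite (big_rem n n_div) /= mulrC Pdiv.IdomainMonic.mulKp //.
exact: Cyclotomic_monic.
Qed.

(* Main.v *)
Require Import Defs.
From mathcomp Require Import all_boot all_order all_algebra all_field.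
From mathcomp Require Import zify ring.

(* Write f for 'Phi_(p q).  Then 'Psi_(p q r) = (x^(qr) - 1) f S with
   S = 1 + x^r + ... + x^((p-1)r), and deg (f S) = tau < qr, so that no terms
   overlap and the height is that of f S.  By Lam and Leung's formula f is the
   difference of two polynomials A B and x C D, where A, C are sums of powers
   of x^p and B, D are sums of powers of x^q.  Since the exponents m r of S are
   distinct modulo p and modulo q, the products A S, B S, C S, D S have
   coefficients 0 or 1; hence those of A B S lie between 0 and the smaller of
   the numbers of terms of A and B, and likewise for C D S. *)

Import Order.TTheory GRing.Theory Num.Theory.
Local Open Scope ring_scope.

(** A divisor of [n * r] prime to [r] divides [n]; any other is [r] times a divisor of [n]. *)
Lemma perm_divisors_mul_prime (n r : nat) :
    (0 < n)%N -> prime r -> ~~ (r %| n)%N ->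
  perm_eq (divisors (n * r)) (divisors n ++ [seq d * r | d <- divisors n]%N).
Proof.
move=> n_gt0 r_prime rNn; have r_gt0 := prime_gt0 r_prime.
have mul_inj : injective (muln^~ r).
  by move=> a b /eqP; rewrite eqn_pmul2r // => /eqP.
apply: uniq_perm; first exact: divisors_uniq.
  rewrite cat_uniq map_inj_uniq ?divisors_uniq //= andbT.
  apply/hasPn => _ /mapP[d _ ->]; rewrite -dvdn_divisors //.
  by apply: contra rNn; apply: dvdn_trans; rewrite dvdn_mull.
move=> x; rewrite mem_cat -!dvdn_divisors ?muln_gt0 ?n_gt0 //.
apply/idP/orP => [x_div|[/dvdn_mulr->//|/mapP[d]]]; last first.
  by rewrite -dvdn_divisors // => d_n ->; rewrite dvdn_pmul2r.
have [r_x|rNx] := boolP (r %| x)%N.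
  right; apply/mapP; exists (x %/ r)%N; last by rewrite divnK.
  by rewrite -dvdn_divisors // -(dvdn_pmul2r r_gt0) divnK.
by left; rewrite -(Gauss_dvdl n (_ : coprime x r)) // coprime_sym prime_coprime.
Qed.

(** Substituting x^r in x^n - 1, the product of the ['Phi_d] for d dividing n, gives x^(n r) - 1,
    whose factors are the ['Phi_d] and ['Phi_(d * r)]. By strong induction the factors for d < n
    cancel. *)
Lemma comp_Cyclotomic (n r : nat) :
    (0 < n)%N -> prime r -> ~~ (r %| n)%N ->
  'Phi_n \Po 'X^r = 'Phi_n * 'Phi_(n * r).
Proof.
elim/ltn_ind: n => n IHn n_gt0 r_prime rNn.
have r_gt0 := prime_gt0 r_prime.
have : \prod_(d <- divisors n) ('Phi_d \Po 'X^r)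
     = \prod_(d <- divisors n) ('Phi_d * 'Phi_(d * r)).
  rewrite -rmorph_prod /= prod_Cyclotomic // rmorphB rmorph1 /= comp_Xn_poly.
  rewrite -exprM mulnC -prod_Cyclotomic ?muln_gt0 ?n_gt0 //.
  rewrite (perm_big _ (perm_divisors_mul_prime _ _ _ _ _)) //=.
  by rewrite big_cat big_map big_split.
have n_div : n \in divisors n by rewrite -dvdn_divisors.
rewrite !(big_rem n n_div) /= [X in _ * X = _](_ : _ =
  \prod_(d <- rem n (divisors n)) ('Phi_d * 'Phi_(d * r))); last first.
  apply: eq_big_seq => d; rewrite mem_rem_uniq ?divisors_uniq // inE.
  rewrite -dvdn_divisors // => /andP[d_neq d_n].
  apply: IHn => //; first by rewrite ltn_neqAle d_neq dvdn_leq.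
    exact: dvdn_gt0 d_n.
  by apply: contra rNn => /dvdn_trans->.
apply: mulIf; apply/monic_neq0/monic_prod => d _.
by rewrite monicMl ?Cyclotomic_monic.
Qed.

(** Follows from x^p - 1 = (x - 1) ['Phi_p] and its composite with x^q. The form without quotients
    lets later proofs work by cancellation. *)
Lemma Cyclotomic_mul_primes (p q : nat) :
    prime p -> prime q -> p != q ->
  ('X^p - 1) * ('X^q - 1) * 'Phi_(p * q) = ('X^(p * q) - 1) * ('X - 1).
Proof.
move=> p_prime q_prime neq_pq.
have Phi1 : 'Phi_1 = 'X - 1.
  by rewrite -['X]expr1 -prod_Cyclotomic // big_seq1.
have XnE m n : ('X^m - 1) \Po 'X^n = 'X^(n * m) - 1 :> {poly int}.
  by rewrite rmorphB rmorph1 /= comp_Xn_poly exprM.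
have PhiP : 'X^p - 1 = ('X - 1) * 'Phi_p :> {poly int}.
  rewrite -[p in 'Phi_p]mul1n -Phi1 -comp_Cyclotomic //;
    last by rewrite dvdn1 gtn_eqF ?prime_gt1.
  by rewrite Phi1 -['X - 1]/('X^1 - 1) XnE muln1.
have PhiPq : 'Phi_p \Po 'X^q = 'Phi_p * 'Phi_(p * q).
  apply: comp_Cyclotomic => //; first exact: prime_gt0.
  by rewrite dvdn_prime2 // eq_sym.
rewrite [in RHS]mulnC -XnE PhiP rmorphM /= PhiPq.
rewrite -['X - 1]/('X^1 - 1) XnE muln1 expr1; ring.
Qed.

(* The second product starts at x^(pq+1)/x^(pq) = x
   since (rho + 1) p + (sigma + 1) q = p q + 1. *)
Lemma Cyclotomic_mul_primesE (p q rho sigma : nat) :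
    prime p -> prime q -> p != q ->
    ((p - 1) * (q - 1) = rho * p + sigma * q)%N ->
  'Phi_(p * q) =
    (\sum_(i < rho + 1) 'X^(i * p)) * (\sum_(j < sigma + 1) 'X^(j * q))
    - 'X * ((\sum_(i < q - 1 - rho) 'X^(i * p))
            * (\sum_(j < p - 1 - sigma) 'X^(j * q))).
Proof.
move=> p_prime q_prime neq_pq rho_sigma.
have p_gt1 := prime_gt1 p_prime; have q_gt1 := prime_gt1 q_prime.
have geoE (a n : nat) :
  ('X^a - 1) * (\sum_(i < n) 'X^(i * a)) = 'X^(a * n) - 1 :> {poly int}.
  rewrite exprM [RHS]subrX1; congr (_ * _); apply: eq_bigr => i _.
  by rewrite mulnC exprM.
have Xn1_neq0 n : (0 < n)%N -> 'X^n - 1 != 0 :> {poly int}.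
  by move=> n_gt0; rewrite monic_neq0 ?monic_Xn_sub_1.
(* These two bounds make the truncated subtractions in the number of terms genuine. *)
have le_rho : (rho <= q - 1)%N by nia.
have le_sigma : (sigma <= p - 1)%N by nia.
have c_neq0 : ('X^p - 1) * ('X^q - 1) != 0 :> {poly int}.
  by rewrite mulf_neq0 ?Xn1_neq0 // ltnW.
apply: (mulfI c_neq0); rewrite Cyclotomic_mul_primes //.
rewrite [RHS](_ : _ =
  (('X^p - 1) * (\sum_(i < rho + 1) 'X^(i * p)))
    * (('X^q - 1) * (\sum_(j < sigma + 1) 'X^(j * q)))
  - 'X * ((('X^p - 1) * (\sum_(i < q - 1 - rho) 'X^(i * p)))
    * (('X^q - 1) * (\sum_(j < p - 1 - sigma) 'X^(j * q)))));
  last by ring.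
rewrite !geoE.
have uvE : 'X^(p * (rho + 1)) * 'X^(q * (sigma + 1)) = 'X * 'X^(p * q)
    :> {poly int}.
  by rewrite -exprD -exprS; congr (_ ^+ _); nia.
have wE : 'X * 'X^(p * (q - 1 - rho)) = 'X^(q * (sigma + 1)) :> {poly int}.
  by rewrite -exprS; congr (_ ^+ _); nia.
have zE : 'X * 'X^(q * (p - 1 - sigma)) = 'X^(p * (rho + 1)) :> {poly int}.
  by rewrite -exprS; congr (_ ^+ _); nia.
have wzE : 'X * ('X^(p * (q - 1 - rho)) * 'X^(q * (p - 1 - sigma)))
    = 'X^(p * q) :> {poly int}.
  by rewrite -exprD -exprS; congr (_ ^+ _); nia.
(* With the powers as indeterminates, the goal (P - 1)(x - 1) = (u - 1)(v - 1) - x (w - 1)(z - 1)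
   follows from u v = x P, x w = v, x z = u and x w z = P. *)
move: uvE wE zE wzE; move: 'X^(p * q) 'X^(p * (rho + 1)) 'X^(q * (sigma + 1)).
move: 'X^(p * (q - 1 - rho)) 'X^(q * (p - 1 - sigma)).
move=> w z P u v uvE wE zE wzE.
by rewrite !(mulrBl, mulrBr, mul1r, mulr1) uvE wE zE wzE; ring.
Qed.

Lemma coef_mul_sum_Xn_le (F : {poly int}) (a n k : nat) :
    (forall i, 0 <= F`_i <= 1) ->
  0 <= (F * \sum_(j < n) 'X^(j * a))`_k <= n%:R.
Proof.
move=> F01; rewrite mulr_sumr coef_sum.
have term01 (j : 'I_n) : 0 <= (F * 'X^(j * a))`_k <= 1.
  by rewrite coefMXn; case: ifP.
apply/andP; split; first by apply: sumr_ge0 => j _; case/andP: (term01 j).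
rewrite -[n in n%:R]card_ord -sumr_const; apply: ler_sum => j _.
by case/andP: (term01 j).
Qed.

(* The residue of i * a + m * r modulo a determines m, and then i. *)
Lemma coef_mul_sums_Xn_le1 (a r s t k : nat) :
    (0 < a)%N -> coprime a r -> (t <= a)%N ->
  0 <= ((\sum_(i < s) 'X^(i * a)) * (\sum_(m < t) 'X^(m * r)) : {poly int})`_k
    <= 1.
Proof.
move=> a_gt0 co_ar le_ta.
(* The coefficient counts the representations of k as i a + m r, so the bound 1 is their
   uniqueness. *)
have -> : ((\sum_(i < s) 'X^(i * a)) * (\sum_(m < t) 'X^(m * r))
    : {poly int})`_k
  = #|[pred im : 'I_s * 'I_t | (k == im.1 * a + im.2 * r)%N]|%:R :> int.
  rewrite big_distrlr /= pair_big coef_sum /=.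
  rewrite -sum1_card natr_sum [RHS]big_mkcond /=.
  by apply: eq_bigr => -[i m] _ /=; rewrite -exprD coefXn inE; case: eqP.
rewrite ler0n lern1 /=; apply/card_le1_eqP => -[i m] [i' m'] /=.
rewrite !inE /= => /eqP-> /eqP eq_k.
have eq_m : m = m'.
  wlog le_mm' : m m' i i' eq_k / (m' <= m)%N.
    by move=> wl; case/orP: (leq_total m' m) => /wl le;
      [apply: le eq_k | symmetry; apply: le (esym eq_k)].
  have : (a %| (m - m') * r)%N.
    rewrite mulnBl -eqn_mod_dvd ?leq_mul2r ?le_mm' ?orbT //.
    by rewrite -(modnMDl i) eq_k modnMDl.
  (* [m - m'] is a multiple of [a] below [t <= a], hence 0. *)
  rewrite Gauss_dvdl // => /dvdnP[c]; have := ltn_ord m.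
  by case: c => [|c] ? ?; apply: val_inj => /=; nia.
have eq_i : i = i'.
  apply: val_inj; apply/eqP; rewrite -(eqn_pmul2r a_gt0).
  by rewrite -(eqn_add2r (m * r)) eq_k eq_m.
by rewrite eq_m eq_i.
Qed.

Lemma abs_sub_le_max (x y : int) (a b : nat) :
  0 <= x <= a%:R -> 0 <= y <= b%:R -> (`|x - y| <= maxn a b)%N.
Proof. by rewrite !natz; lia. Qed.

(** The copies -G and x^n G occupy disjoint ranges of exponents. *)
Lemma coef_Xn_sub1_mul (G : {poly int}) (n k : nat) :
  (size G <= n)%N -> exists i, `|((('X^n - 1) * G)`_k)%R|%N = `|(G`_i)%R|%N.
Proof.
move=> le_Gn; rewrite mulrBl mul1r mulrC coefB coefMXn.
case: ltnP => [_|le_nk]; first by exists k; rewrite sub0r abszN.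
by exists (k - n)%N; rewrite [G`_k]nth_default ?subr0 // (leq_trans le_Gn).
Qed.

(** Substitute x^r in (x^q - 1)(1 + ... + x^(p-1)) ['Phi_(p * q)] = x^(p q) - 1, split
    ['Phi_(p * q)] at x^r by [comp_Cyclotomic], and cancel ['Phi_(p * q * r)]. *)
Lemma inverse_Cyclotomic_mul_primes3 (p q r : nat) :
    prime p -> prime q -> prime r -> p != q -> p != r -> q != r ->
  'Psi_(p * q * r) =
    ('X^(q * r) - 1) * ('Phi_(p * q) * \sum_(m < p) 'X^(m * r)).
Proof.
move=> p_prime q_prime r_prime neq_pq neq_pr neq_qr.
have p_gt0 := prime_gt0 p_prime; have q_gt0 := prime_gt0 q_prime.
have r_gt0 := prime_gt0 r_prime.
have Phi_pqr : 'Phi_(p * q) \Po 'X^r = 'Phi_(p * q) * 'Phi_(p * q * r).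
  apply: comp_Cyclotomic; rewrite ?muln_gt0 ?p_gt0 //.
  by rewrite Euclid_dvdM // !dvdn_prime2 // negb_or eq_sym neq_pr eq_sym.
have Psi_pq : ('X^q - 1) * (\sum_(m < p) 'X^m) * 'Phi_(p * q)
    = 'X^(p * q) - 1 :> {poly int}.
  apply: (mulfI (monic_neq0 (monicXsubC 1))).
  rewrite [RHS]mulrC -Cyclotomic_mul_primes // (subrX1 _ p); ring.
apply: (mulIf (monic_neq0 (Cyclotomic_monic (p * q * r)))).
rewrite inverse_CyclotomicM ?muln_gt0 ?p_gt0 ?q_gt0 //.
rewrite -mulrA mulrAC -Phi_pqr.
have := congr1 (fun F => F \Po 'X^r) Psi_pq.
rewrite !rmorphM !rmorphB !rmorph1 /= !comp_Xn_poly raddf_sum /=.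
rewrite -!exprM (mulnC r) (mulnC r (p * q)) => <-.
rewrite -mulrA; congr (_ * _); rewrite mulrC; congr (_ * _).
by apply: eq_bigr => m _; rewrite comp_Xn_poly -exprM mulnC.
Qed.

Local Open Scope nat_scope.

Theorem theorem7 (p q r rho sigma tau : nat)
    (p_prime : prime p) (q_prime : prime q) (r_prime : prime r)
    (p_odd : odd p) (q_odd : odd q) (r_odd : odd r)
    (ltpq : p < q) (ltqr : q < r)
    (rho_sigma : (p - 1) * (q - 1) = rho * p + sigma * q)
    (tauE : tau = (p - 1) * (q + r - 1))
    (lt_tau : tau < q * r) :
  height 'Psi_(p * q * r) <=
    maxn (minn (rho + 1) (sigma + 1)) (minn (q - 1 - rho) (p - 1 - sigma)).
Proof.
have p_gt1 := prime_gt1 p_prime; have q_gt1 := prime_gt1 q_prime.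
have neq_pq : p != q by rewrite ltn_eqF.
have neq_pr : p != r by rewrite ltn_eqF // (ltn_trans ltpq).
have neq_qr : q != r by rewrite ltn_eqF.
rewrite /height inverse_Cyclotomic_mul_primes3 //.
set G := ('Phi_(p * q) * _)%R.
have size_G : size G <= q * r.
  apply: leq_trans (size_polyMleq _ _) _.
  have size_S :
    size (\sum_(m < p) 'X^(m * r) : {poly int})%R <= ((p - 1) * r).+1.
    apply: (leq_trans (size_sum _ _ _)); apply/bigmax_leqP => m _.
    have le_m : m <= p - 1 by have := ltn_ord m; lia.
    by rewrite size_polyXn ltnS leq_mul2r le_m orbT.
  rewrite size_Cyclotomic totient_coprime ?totient_prime //; last first.
    by rewrite prime_coprime // dvdn_prime2.
  (* The summands are the degree of ['Phi_(p * q)] and the bound for that of the sum. *)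
  have tauD : tau = p.-1 * q.-1 + (p - 1) * r.
    by rewrite tauE -!subn1 -mulnDr; congr (_ * _); lia.
  by lia.
suff coefG i : `|(G`_i)%R| <= maxn (minn (rho + 1) (sigma + 1))
                                 (minn (q - 1 - rho) (p - 1 - sigma)).
  apply/bigmax_leqP => k _.
  by have [i ->] := coef_Xn_sub1_mul G (q * r) k size_G.
pose S : {poly int} := (\sum_(m < p) 'X^(m * r))%R.
have bound s t k : t <= p ->
  (0 <= ((\sum_(i < s) 'X^(i * p)) * (\sum_(j < t) 'X^(j * q)) * S)`_k
     <= (minn s t)%:R)%R.
  move=> le_tp.
  set F := (_ * _ * S)%R.
  (* Grouping the sum in x^p with [S] leaves [t] shifts of a 0-1 polynomial; below, grouping the sum
     in x^q with [S] leaves [s] shifts, the [p] exponents of [S] being distinct modulo [q] as p <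
     q. *)
  have le_t : (0 <= F`_k <= t%:R)%R.
    rewrite /F mulrAC; apply: coef_mul_sum_Xn_le => l.
    apply: coef_mul_sums_Xn_le1; rewrite ?(ltnW p_gt1) //.
    by rewrite prime_coprime // dvdn_prime2.
  have le_s : (0 <= F`_k <= s%:R)%R.
    rewrite /F -mulrA mulrC; apply: coef_mul_sum_Xn_le => l.
    apply: coef_mul_sums_Xn_le1; rewrite ?(ltnW q_gt1) ?(ltnW ltpq) //.
    by rewrite prime_coprime // dvdn_prime2.
  by rewrite /minn; case: ifP.
have le_sigma : sigma + 1 <= p.
  rewrite addn1 -(ltn_pmul2r (ltnW q_gt1)).
  rewrite (leq_ltn_trans (leq_addl (rho * p) _)) //.
  by rewrite -rho_sigma ltn_mul ?ltn_subrL ?(ltnW p_gt1) ?(ltnW q_gt1).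
rewrite /G (Cyclotomic_mul_primesE _ _ rho sigma) // -/S mulrBl coefB.
apply: abs_sub_le_max; first exact: bound.
(* The factor x shifts the coefficients by one and makes the constant term 0. *)
rewrite -mulrA coefXM; case: ifP => _; first by rewrite lexx ler0n.
by apply: bound; lia.
Qed.
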